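(* There is no smooth function $u:\mathbb{R}^2\to\mathbb{R}$ satisfying all of the following: (i) $-\Delta u = x_1 e^{u}$ in $\mathbb{R}^2$, where $x=(x_1,x_2)$; (ii) $u(x)\le u(0)=0$ for all $x\in\mathbb{R}^2$; (iii) $\int_{\mathbb{R}^2}|x_1|e^{u(x)}\,dx<+\infty$; (iv) $A:=\int_{\mathbb{R}^2}x_1 e^{u(x)}\,dx>0$. *)

(* Defs.v *)
From Stdlib Require Import Reals.
Open Scope R_scope.

Definition cont2 (f : R -> R -> R) : Prop :=
  forall x1 x2 eps, 0 < eps -> exists delta, 0 < delta /\
    forall y1 y2, Rabs (y1 - x1) < delta -> Rabs (y2 - x2) < delta ->
      Rabs (f y1 y2 - f x1 x2) < eps.

Definition is_d1 (f g : R -> R -> R) : Prop :=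
  forall x1 x2, derivable_pt_lim (fun t => f t x2) x1 (g x1 x2).
Definition is_d2 (f g : R -> R -> R) : Prop :=
  forall x1 x2, derivable_pt_lim (fun t => f x1 t) x2 (g x1 x2).

Fixpoint Ck (k : nat) (f : R -> R -> R) : Prop :=
  cont2 f /\
  match k with
  | O => True
  | S k' => exists f1 f2, is_d1 f f1 /\ is_d2 f f2 /\ Ck k' f1 /\ Ck k' f2
  end.

Definition smooth2 (f : R -> R -> R) : Prop := forall k, Ck k f.

Definition sq_int (f : R -> R -> R) (r v : R) : Prop :=
  exists g : R -> R,
    (forall x1, -r <= x1 <= r ->
       exists pr : Riemann_integrable (fun x2 => f x1 x2) (-r) r,
         RiemannInt pr = g x1) /\
    exists pr : Riemann_integrable g (-r) r, RiemannInt pr = v.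

(* Main.v *)
Require Import Defs.
From Stdlib Require Import Reals.
From Stdlib Require Import Lra.
From Coquelicot Require Import Coquelicot.
Open Scope R_scope.

(** The contradiction is local, at third order at the origin. Since 0 is a
    maximum point, the Hessian of [u] there is negative semidefinite; by (i) its
    trace is 0, so it vanishes. The cubic Taylor term is then nonpositive and
    odd, so it vanishes too. But differentiating (i) in [x1] at 0 gives
    [u_111 + u_221 = -1]. *)

(** * One-variable derivative tests at a maximum *)

Lemma derive_pos_right (f : R -> R) (l : R) :
  derivable_pt_lim f 0 l -> f 0 = 0 -> 0 < l ->
  exists d, 0 < d /\ forall t, 0 < t < d -> 0 < f t.
Proof.
  intros Hf f0 Hl.
  (* The tolerance is [l] itself: a difference quotient within [l] of [l] is positive. *)
  destruct (Hf l Hl) as [d Hd].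
  exists d; split; [apply cond_pos|].
  intros t Ht.
  assert (H : Rabs ((f (0 + t) - f 0) / t - l) < l).
  { apply Hd; [lra|]. rewrite Rabs_pos_eq; lra. }
  rewrite f0, Rplus_0_l, Rminus_0_r in H.
  apply Rabs_def2 in H.
  replace (f t) with (f t / t * t) by (field; lra).
  apply Rmult_lt_0_compat; lra.
Qed.

(** By the mean value theorem. Iterating it carries positivity from a higher derivative down to the
    function, so no Taylor expansion is needed. *)
Lemma antiderivative_pos_right (f f' : R -> R) :
  (forall t, derivable_pt_lim f t (f' t)) -> f 0 = 0 ->
  (exists d, 0 < d /\ forall t, 0 < t < d -> 0 < f' t) ->
  exists d, 0 < d /\ forall t, 0 < t < d -> 0 < f t.
Proof.
  intros Hf f0 [d [Hd H]].
  exists d; split; [exact Hd|].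
  intros t Ht.
  destruct (MVT_cor2 f f' 0 t) as [c [Hc Hct]]; [lra|auto|].
  rewrite f0, Rminus_0_r, Rminus_0_r in Hc. rewrite Hc.
  apply Rmult_lt_0_compat; [apply H|]; lra.
Qed.

Lemma nonpos_not_pos_right (f : R -> R) :
  (forall t, f t <= 0) ->
  ~ exists d, 0 < d /\ forall t, 0 < t < d -> 0 < f t.
Proof.
  intros Hf [d [Hd H]].
  specialize (Hf (d / 2)). specialize (H (d / 2)). lra.
Qed.

Lemma derivable_pt_lim_reflect (f : R -> R) (t l : R) :
  derivable_pt_lim f (- t) l -> derivable_pt_lim (fun s => f (- s)) t (- l).
Proof.
  intros Hf.
  replace (- l) with (l * - (1)) by ring.
  apply (derivable_pt_lim_comp (fun s => - s) f); [|exact Hf].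
  apply (derivable_pt_lim_opp id), derivable_pt_lim_id.
Qed.

Lemma max_derive_le_0 (f : R -> R) (l : R) :
  (forall t, f t <= 0) -> f 0 = 0 -> derivable_pt_lim f 0 l -> l <= 0.
Proof.
  intros Hf f0 Hl. apply Rnot_lt_le; intros H.
  exact (nonpos_not_pos_right f Hf (derive_pos_right f l Hl f0 H)).
Qed.

(** The one-sided test applies to [f] and to its reflection, which has derivative [- l] at 0. *)
Lemma max_derive_eq_0 (f : R -> R) (l : R) :
  (forall t, f t <= 0) -> f 0 = 0 -> derivable_pt_lim f 0 l -> l = 0.
Proof.
  intros Hf f0 Hl.
  assert (l <= 0) by exact (max_derive_le_0 f l Hf f0 Hl).
  assert (- l <= 0).
  { apply (max_derive_le_0 (fun s => f (- s))); auto.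
    - now rewrite Ropp_0.
    - apply derivable_pt_lim_reflect. now rewrite Ropp_0. }
  lra.
Qed.

Lemma max_derive2_le_0 (f f1 : R -> R) (l : R) :
  (forall t, f t <= 0) -> f 0 = 0 ->
  (forall t, derivable_pt_lim f t (f1 t)) ->
  derivable_pt_lim f1 0 l -> l <= 0.
Proof.
  intros Hf f0 H1 H2.
  assert (f1 0 = 0) by (apply (max_derive_eq_0 f); auto).
  apply Rnot_lt_le; intros Hl.
  apply (nonpos_not_pos_right f Hf).
  apply (antiderivative_pos_right f f1); auto.
  now apply (derive_pos_right f1 l).
Qed.

(** If [l] were positive, then [f2], [f1] and [f] in turn would be positive just to the right of 0,
    each vanishing at 0. *)
Lemma max_derive3_le_0 (f f1 f2 : R -> R) (l : R) :
  (forall t, f t <= 0) -> f 0 = 0 ->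
  (forall t, derivable_pt_lim f t (f1 t)) ->
  (forall t, derivable_pt_lim f1 t (f2 t)) ->
  derivable_pt_lim f2 0 l -> f2 0 = 0 -> l <= 0.
Proof.
  intros Hf f0 H1 H2 H3 f20.
  assert (f1 0 = 0) by (apply (max_derive_eq_0 f); auto).
  apply Rnot_lt_le; intros Hl.
  apply (nonpos_not_pos_right f Hf).
  apply (antiderivative_pos_right f f1); auto.
  apply (antiderivative_pos_right f1 f2); auto.
  now apply (derive_pos_right f2 l).
Qed.

(** Three is odd: reflection preserves the maximum and [f2 0 = 0] but negates the third
    derivative. *)
Lemma max_derive3_eq_0 (f f1 f2 : R -> R) (l : R) :
  (forall t, f t <= 0) -> f 0 = 0 ->
  (forall t, derivable_pt_lim f t (f1 t)) ->
  (forall t, derivable_pt_lim f1 t (f2 t)) ->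
  derivable_pt_lim f2 0 l -> f2 0 = 0 -> l = 0.
Proof.
  intros Hf f0 H1 H2 H3 f20.
  assert (l <= 0) by now apply (max_derive3_le_0 f f1 f2).
  assert (- l <= 0).
  { apply (max_derive3_le_0 (fun s => f (- s)) (fun s => - f1 (- s))
             (fun s => f2 (- s))); auto.
    - now rewrite Ropp_0.
    - intros t. apply derivable_pt_lim_reflect, H1.
    - intros t. rewrite <- (Ropp_involutive (f2 (- t))).
      apply (derivable_pt_lim_opp (fun s => f1 (- s))).
      apply derivable_pt_lim_reflect, H2.
    - apply derivable_pt_lim_reflect. now rewrite Ropp_0.
    - now rewrite Ropp_0. }
  lra.
Qed.

(** * Calculus of functions of two variables *)

Lemma cont2_continuity_2d (f : R -> R -> R) (x y : R) :
  cont2 f -> continuity_2d_pt f x y.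
Proof.
  intros Hf eps.
  destruct (Hf x y eps (cond_pos eps)) as [d [Hd H]].
  exists (mkposreal d Hd). exact H.
Qed.

Lemma Rabs_between (x u c : R) :
  Rmin x u <= c <= Rmax x u -> Rabs (c - x) <= Rabs (u - x).
Proof.
  unfold Rmin, Rmax; destruct (Rle_dec x u); intros H;
    unfold Rabs; do 2 destruct Rcase_abs; lra.
Qed.

(** The absolute values cover both orders of [a] and [b], and place [c] directly in the
    neighbourhoods used by [cont2]. *)
Lemma mvt_between (f f' : R -> R) (a b : R) :
  (forall t, derivable_pt_lim f t (f' t)) ->
  exists c, Rabs (c - a) <= Rabs (b - a) /\ f b - f a = f' c * (b - a).
Proof.
  intros Hf.
  destruct (MVT_gen f a b f') as [c [Hc H]].
  - intros t _. apply is_derive_Reals, Hf.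
  - intros t _. apply derivable_continuous_pt. exists (f' t). apply Hf.
  - exists c. split; [now apply Rabs_between|exact H].
Qed.

(** The increment is split at the corner [(x, v)] into a horizontal and a vertical one. The mean
    value theorem turns each into a partial derivative at a nearby point, and continuity of the
    partials bounds each error by half of [eps]. *)
Lemma C1_differentiable (f f1 f2 : R -> R -> R) (x y : R) :
  is_d1 f f1 -> is_d2 f f2 -> cont2 f1 -> cont2 f2 ->
  differentiable_pt_lim f x y (f1 x y) (f2 x y).
Proof.
  intros H1 H2 C1 C2 eps.
  assert (He : 0 < eps / 2) by (generalize (cond_pos eps); lra).
  destruct (C1 x y _ He) as [d1 [Hd1 K1]].
  destruct (C2 x y _ He) as [d2 [Hd2 K2]].
  exists (mkposreal (Rmin d1 d2) (Rmin_pos _ _ Hd1 Hd2)); simpl.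
  intros u v Hu Hv.
  assert (Rmin d1 d2 <= d1) by apply Rmin_l.
  assert (Rmin d1 d2 <= d2) by apply Rmin_r.
  destruct (mvt_between (fun t => f t v) (fun t => f1 t v) x u) as [c [Hc E1]].
  { intros t. apply H1. }
  destruct (mvt_between (fun t => f x t) (fun t => f2 x t) y v) as [e [Hce E2]].
  { intros t. apply H2. }
  assert (A1 : Rabs (f1 c v - f1 x y) < eps / 2) by (apply K1; lra).
  assert (A2 : Rabs (f2 x e - f2 x y) < eps / 2).
  { apply K2; [rewrite Rminus_diag, Rabs_R0|]; lra. }
  replace (f u v - f x y - (f1 x y * (u - x) + f2 x y * (v - y)))
    with ((f1 c v - f1 x y) * (u - x) + (f2 x e - f2 x y) * (v - y)) by lra.
  eapply Rle_trans; [apply Rabs_triang|].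
  rewrite !Rabs_mult.
  set (m := Rmax (Rabs (u - x)) (Rabs (v - y))).
  assert (M1 : Rabs (u - x) <= m) by apply Rmax_l.
  assert (M2 : Rabs (v - y) <= m) by apply Rmax_r.
  replace (eps * m) with (eps / 2 * m + eps / 2 * m) by field.
  apply Rplus_le_compat; apply Rmult_le_compat; auto using Rabs_pos; lra.
Qed.

Lemma derivable_along_line (f f1 f2 : R -> R -> R) (a b t : R) :
  is_d1 f f1 -> is_d2 f f2 -> cont2 f1 -> cont2 f2 ->
  derivable_pt_lim (fun s => f (a * s) (b * s)) t
    (a * f1 (a * t) (b * t) + b * f2 (a * t) (b * t)).
Proof.
  intros H1 H2 C1 C2.
  rewrite (Rmult_comm a (f1 _ _)), (Rmult_comm b (f2 _ _)).
  assert (L : forall k, derivable_pt_lim (fun s => k * s) t k).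
  { intros k.
    (* This changes only the derivative value from [k] to [k * 1] and leaves the [k] inside the
       function alone. *)
    apply (eq_ind (k * 1) (derivable_pt_lim (fun s => k * s) t)); [|ring].
    apply (derivable_pt_lim_scal id), derivable_pt_lim_id. }
  apply (derivable_pt_lim_comp_2d f (fun s => a * s) (fun s => b * s)); auto.
  now apply C1_differentiable.
Qed.

(** Coquelicot's [Schwarz] speaks of iterated [Derive], so the relational partials are first
    identified with it. *)
Lemma mixed_partials_eq (f f1 f2 f12 f21 : R -> R -> R) :
  is_d1 f f1 -> is_d2 f f2 -> is_d2 f1 f12 -> is_d1 f2 f21 ->
  cont2 f12 -> cont2 f21 -> forall x y, f12 x y = f21 x y.
Proof.
  intros H1 H2 H12 H21 C12 C21 x y.
  assert (D1 : forall u v, Derive (fun t => f t v) u = f1 u v).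
  { intros u v. apply is_derive_unique, is_derive_Reals, H1. }
  assert (D2 : forall u v, Derive (fun t => f u t) v = f2 u v).
  { intros u v. apply is_derive_unique, is_derive_Reals, H2. }
  assert (D12 : forall u v, is_derive (fun z => Derive (fun t => f t z) u) v (f12 u v)).
  { intros u v. apply (is_derive_ext (fun z => f1 u z)); [now intros; rewrite D1|].
    apply is_derive_Reals, H12. }
  assert (D21 : forall u v, is_derive (fun z => Derive (fun t => f z t) v) u (f21 u v)).
  { intros u v. apply (is_derive_ext (fun z => f2 z v)); [now intros; rewrite D2|].
    apply is_derive_Reals, H21. }
  rewrite <- (is_derive_unique _ _ _ (D12 x y)), <- (is_derive_unique _ _ _ (D21 x y)).
  symmetry. apply Schwarz.
  - apply locally_2d_forall. intros u v. repeat split.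
    + exists (f1 u v). apply is_derive_Reals, H1.
    + exists (f2 u v). apply is_derive_Reals, H2.
    + exists (f21 u v). apply D21.
    + exists (f12 u v). apply D12.
  - apply (continuity_2d_pt_ext f21); [|now apply cont2_continuity_2d].
    intros u v. symmetry. apply is_derive_unique, D21.
  - apply (continuity_2d_pt_ext f12); [|now apply cont2_continuity_2d].
    intros u v. symmetry. apply is_derive_unique, D12.
Qed.

Lemma is_d1_unique (f g h : R -> R -> R) :
  is_d1 f g -> is_d1 f h -> forall x y, g x y = h x y.
Proof. intros Hg Hh x y. eapply uniqueness_limite; [apply Hg|apply Hh]. Qed.

Lemma is_d2_unique (f g h : R -> R -> R) :
  is_d2 f g -> is_d2 f h -> forall x y, g x y = h x y.
Proof. intros Hg Hh x y. eapply uniqueness_limite; [apply Hg|apply Hh]. Qed.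

Lemma is_d1_ext (f g h : R -> R -> R) :
  (forall x y, f x y = g x y) -> is_d1 f h -> is_d1 g h.
Proof.
  intros E Hf x y. apply is_derive_Reals.
  apply (is_derive_ext (fun t => f t y)); [now intros|].
  apply is_derive_Reals, Hf.
Qed.

Lemma is_d2_ext (f g h : R -> R -> R) :
  (forall x y, f x y = g x y) -> is_d2 f h -> is_d2 g h.
Proof.
  intros E Hf x y. apply is_derive_Reals.
  apply (is_derive_ext (fun t => f x t)); [now intros|].
  apply is_derive_Reals, Hf.
Qed.

Lemma Ck_cont2 (k : nat) (f : R -> R -> R) : Ck k f -> cont2 f.
Proof. destruct k; intros H; apply H. Qed.

(** * The third-order obstruction at a maximum *)

Lemma max_trace0_laplacian_d1_eq_0
  (u u1 u2 u11 u12 u21 u22 : R -> R -> R) (l : R) :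
  is_d1 u u1 -> is_d2 u u2 ->
  is_d1 u1 u11 -> is_d2 u1 u12 -> is_d1 u2 u21 -> is_d2 u2 u22 ->
  cont2 u1 -> cont2 u2 -> Ck 1 u11 -> Ck 1 u12 -> Ck 1 u21 -> Ck 1 u22 ->
  u 0 0 = 0 -> (forall x y, u x y <= 0) ->
  u11 0 0 + u22 0 0 = 0 ->
  derivable_pt_lim (fun t => u11 t 0 + u22 t 0) 0 l ->
  l = 0.
Proof.
  intros H1 H2 H11 H12 H21 H22 C1 C2
    [C11 [u111 [u112 [H111 [H112 [C111 C112]]]]]]
    [C12 [u121 [u122 [H121 [H122 [C121 C122]]]]]]
    [C21 [u211 [u212 [H211 [H212 [C211 C212]]]]]]
    [C22 [u221 [u222 [H221 [H222 [C221 C222]]]]]] u0 Hmax Htr Hl.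
  apply Ck_cont2 in C111, C112, C121, C122, C211, C212, C221, C222.
  assert (E12 : forall x y, u12 x y = u21 x y).
  { now apply (mixed_partials_eq u u1 u2). }
  (* Indices record the order of differentiation. Identifying [u122], [u212] and [u221] at the
     origin merges the mixed terms of the cubic form into three times [u221]. *)
  assert (E122 : u122 0 0 = u212 0 0).
  { apply (is_d2_unique u21); [|exact H212]. now apply (is_d2_ext u12). }
  assert (E212 : u212 0 0 = u221 0 0).
  { now apply (mixed_partials_eq u2 u21 u22). }
  (* [Q] and [T] are the second and third derivatives along the direction [(a, b)], left
     unsymmetrised, exactly as repeated use of the chain rule produces them. *)
  set (Q a b x y := a * (a * u11 x y + b * u12 x y)
                    + b * (a * u21 x y + b * u22 x y)).
  set (T a b := a * (a * (a * u111 0 0 + b * u112 0 0)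
                     + b * (a * u121 0 0 + b * u122 0 0))
              + b * (a * (a * u211 0 0 + b * u212 0 0)
                     + b * (a * u221 0 0 + b * u222 0 0))).
  assert (D1 : forall a b t, derivable_pt_lim (fun s => u (a * s) (b * s)) t
                 (a * u1 (a * t) (b * t) + b * u2 (a * t) (b * t))).
  { intros. now apply derivable_along_line. }
  assert (D2 : forall a b t, derivable_pt_lim
                 (fun s => a * u1 (a * s) (b * s) + b * u2 (a * s) (b * s)) t
                 (Q a b (a * t) (b * t))).
  { intros. unfold Q.
    apply (derivable_pt_lim_plus (fun s => a * u1 (a * s) (b * s))
             (fun s => b * u2 (a * s) (b * s)));
      [ apply (derivable_pt_lim_scal (fun s => u1 (a * s) (b * s)))
      | apply (derivable_pt_lim_scal (fun s => u2 (a * s) (b * s))) ];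
      now apply derivable_along_line. }
  assert (D3 : forall a b, derivable_pt_lim (fun s => Q a b (a * s) (b * s)) 0 (T a b)).
  { intros. unfold Q, T.
    assert (L : forall f f1 f2, is_d1 f f1 -> is_d2 f f2 -> cont2 f1 -> cont2 f2 ->
              derivable_pt_lim (fun s => f (a * s) (b * s)) 0
                (a * f1 0 0 + b * f2 0 0)).
    { intros f f1 f2 F1 F2 G1 G2.
      generalize (derivable_along_line f f1 f2 a b 0 F1 F2 G1 G2).
      now rewrite !Rmult_0_r. }
    assert (L2 : forall f g c d m n, derivable_pt_lim f 0 m -> derivable_pt_lim g 0 n ->
              derivable_pt_lim (fun s => c * f s + d * g s) 0 (c * m + d * n)).
    { intros. apply (derivable_pt_lim_plus (fun s => c * f s) (fun s => d * g s));
        [apply (derivable_pt_lim_scal f)|apply (derivable_pt_lim_scal g)]; auto. }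
    apply (L2 (fun s => a * u11 (a * s) (b * s) + b * u12 (a * s) (b * s))
             (fun s => a * u21 (a * s) (b * s) + b * u22 (a * s) (b * s)));
      [ apply (L2 (fun s => u11 (a * s) (b * s)) (fun s => u12 (a * s) (b * s)))
      | apply (L2 (fun s => u21 (a * s) (b * s)) (fun s => u22 (a * s) (b * s))) ];
      now apply L. }
  assert (u0ab : forall a b, u (a * 0) (b * 0) = 0) by (intros; now rewrite !Rmult_0_r).
  assert (Qle : forall a b, Q a b 0 0 <= 0).
  { intros a b.
    apply (max_derive2_le_0 (fun s => u (a * s) (b * s))
             (fun s => a * u1 (a * s) (b * s) + b * u2 (a * s) (b * s))); auto.
    generalize (D2 a b 0). now rewrite !Rmult_0_r. }
  assert (T0 : forall a b, Q a b 0 0 = 0 -> T a b = 0).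
  { intros a b H.
    apply (max_derive3_eq_0 (fun s => u (a * s) (b * s))
             (fun s => a * u1 (a * s) (b * s) + b * u2 (a * s) (b * s))
             (fun s => Q a b (a * s) (b * s))); auto.
    now rewrite !Rmult_0_r. }
  assert (Hlim : l = u111 0 0 + u221 0 0).
  { eapply uniqueness_limite; [exact Hl|].
    apply (derivable_pt_lim_plus (fun t => u11 t 0) (fun t => u22 t 0)); auto. }
  (* The two axis values of [Q] are nonpositive with sum 0, so both vanish. The values along [(1,1)]
     and [(1,-1)] then also sum to 0, so they vanish too, which allows [T0] in the three directions
     used. [T 1 0] is [u111] at the origin. *)
  generalize (Qle 1 0) (Qle 0 1) (Qle 1 1) (Qle 1 (-1))
    (T0 1 0) (T0 1 1) (T0 1 (-1)).
  specialize (E12 0 0). unfold Q, T.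
  intros Q10 Q01 Qp Qm T10 Tp Tm.
  assert (T10' := T10 ltac:(lra)).
  assert (Tp' := Tp ltac:(lra)).
  assert (Tm' := Tm ltac:(lra)).
  (* The cubic forms along (1,1) and (1,-1) add up to 2 u_111 + 6 u_221. *)
  lra.
Qed.

Theorem theorem1 :
  ~ exists u : R -> R -> R,
      smooth2 u /\
      (* (i)  - Laplacian u = x1 e^u *)
      (exists u1 u11 u2 u22 : R -> R -> R,
          is_d1 u u1 /\ is_d1 u1 u11 /\ is_d2 u u2 /\ is_d2 u2 u22 /\
          forall x1 x2, - (u11 x1 x2 + u22 x1 x2) = x1 * exp (u x1 x2)) /\
      (* (ii) u <= u(0) = 0 *)
      u 0 0 = 0 /\ (forall x1 x2, u x1 x2 <= u 0 0) /\
      (* (iii) int |x1| e^u < +oo *)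
      (exists M : R, forall n : nat, exists v : R,
          sq_int (fun x1 x2 => Rabs x1 * exp (u x1 x2)) (INR n) v /\ v <= M) /\
      (* (iv) A = int x1 e^u > 0 *)
      (exists (A : R) (s : nat -> R), 0 < A /\
          (forall n : nat, sq_int (fun x1 x2 => x1 * exp (u x1 x2)) (INR n) (s n)) /\
          Un_cv s A).
Proof.
  intros [u [Hs [[v1 [v11 [v2 [v22 [V1 [V11 [V2 [V22 Heq]]]]]]]] [u0 [Hmax _]]]]].
  (* Order 3 leaves [Ck 1] for each second partial, as the cubic form requires. *)
  destruct (Hs 3%nat) as [_ [u1 [u2 [H1 [H2
    [[C1 [u11 [u12 [H11 [H12 [K11 K12]]]]]] [C2 [u21 [u22 [H21 [H22 [K21 K22]]]]]]]]]]]].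
  (* The partials in (i) and those from [smooth2] are separate witnesses. Uniqueness of derivatives
     identifies them pointwise. *)
  assert (E11 : forall x y, v11 x y = u11 x y).
  { apply (is_d1_unique u1); [|exact H11].
    apply (is_d1_ext v1); [now apply (is_d1_unique u)|exact V11]. }
  assert (E22 : forall x y, v22 x y = u22 x y).
  { apply (is_d2_unique u2); [|exact H22].
    apply (is_d2_ext v2); [now apply (is_d2_unique u)|exact V22]. }
  assert (Lap : forall x y, u11 x y + u22 x y = - (x * exp (u x y))).
  { intros x y. rewrite <- Heq, E11, E22. ring. }
  (* Here [-1] is the derivative at 0 of [- (t * exp (u t 0))]: the factor [t] kills the term
     containing [u1], and [exp (u 0 0) = 1]. *)
  assert (-1 = 0); [|lra].
  apply (max_trace0_laplacian_d1_eq_0 u u1 u2 u11 u12 u21 u22); auto.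
  - intros x y. rewrite <- u0. apply Hmax.
  - rewrite Lap. ring.
  - apply is_derive_Reals.
    apply (is_derive_ext (fun t => - (t * exp (u t 0)))); [now intros|].
    apply is_derive_Reals.
    replace (-1) with (- (1 * exp (u 0 0) + 0 * (exp (u 0 0) * u1 0 0)))
      by (rewrite u0, exp_0; ring).
    apply (derivable_pt_lim_opp (fun t => t * exp (u t 0))).
    apply (derivable_pt_lim_mult id (fun t => exp (u t 0)));
      [apply derivable_pt_lim_id|].
    apply (derivable_pt_lim_comp (fun t => u t 0) exp); [apply H1|].
    apply derivable_pt_lim_exp.
Qed.
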